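(* Let $X$ be a ball quasi-Banach function space on $\mathbb R^n$ satisfying the triangle inequality $\|f+g\|_X\le\|f\|_X+\|g\|_X$ for any $f,g\in X$, let $E$ be a measurable subset of $\mathbb R^n$, and let $F$ be a measurable function on $\mathbb R^n\times E$. Then $$\Big\|\int_E|F(\cdot,y)|\,dy\Big\|_X\le|E|\,\sup_{y\in E}\|F(\cdot,y)\|_X.$$
   Context: Ball quasi-Banach function space: let $\mathscr M(\mathbb R^n)$ be the set of all measurable functions on $\mathbb R^n$. A quasi-Banach space $X\subset\mathscr M(\mathbb R^n)$ (with $\|f\|_X=\infty$ for $f\notin X$) is a ball quasi-Banach function space if: $\|f\|_X=0$ implies $f=0$ a.e.; $|g|\le|f|$ a.e. implies $\|g\|_X\le\|f\|_X$; $0\le f_m\uparrow f$ a.e. implies $\|f_m\|_X\uparrow\|f\|_X$; and $\mathbf 1_B\in X$ for every ball $B$. $|E|$ denotes the Lebesgue measure of $E$. *)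

(* Defs.v *)
From HB Require Import structures.
From mathcomp Require Import all_boot all_order all_algebra.
From mathcomp Require Import all_classical all_reals all_analysis.
From mathcomp Require Import measurable_realfun.
Set Implicit Arguments.
Unset Strict Implicit.
Unset Printing Implicit Defensive.
Import Order.TTheory GRing.Theory Num.Theory.
Import numFieldNormedType.Exports.
Local Open Scope classical_set_scope.
Local Open Scope ring_scope.

Section borel_lebesgue.
Context (R : realType).
Local Open Scope ereal_scope.

(* Lebesgue measure on the Borel sets of R^n, by slicing along the first
   coordinate; see borel_lebesgue_box for its values on boxes. *)
Fixpoint borel_lebesgue (n : nat) : set (n.-tuple (measurableTypeR R)) -> \bar R :=
  match n with
  | 0%N => \d_([tuple])
  | m.+1 => fun A => \int[@lebesgue_measure R]_x
      borel_lebesgue [set t : m.-tuple (measurableTypeR R) | A [tuple of x :: t]]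
  end.

Let T := measurableTypeR R.

Let cons_fun n (p : T * n.-tuple T) : n.+1.-tuple T := [tuple of p.1 :: p.2].

Let measurable_cons_fun n : measurable_fun setT (@cons_fun n).
Proof. exact: measurable_cons. Qed.

Let borel_lebesgue_ex n : exists m : {sigma_finite_measure set (n.-tuple T) -> \bar R},
  forall A, borel_lebesgue A = m A.
Proof.
elim: n => [|n [m IH]]; first by exists \d_([tuple]).
pose l : {sigma_finite_measure set T -> \bar R} := @lebesgue_measure R.
pose p : {measure set (T * n.-tuple T)%type -> \bar R} := l \x m.
pose q0 := pushforward p (@cons_fun n) : {measure set (n.+1.-tuple T) -> \bar R}.
pose q := q0 (@measurable_cons_fun n).
have qs : sigma_finite setT q.
  have /sigma_finiteP[F [TF ndF Foo]] := sigma_finiteT l.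
  have /sigma_finiteP[G [TG ndG Goo]] := sigma_finiteT m.
  pose g (t : n.+1.-tuple T) : T * n.-tuple T := (thead t, [tuple of behead t]).
  have gK : cancel (@cons_fun n) g.
    by move=> [x t]; rewrite /g /cons_fun theadE; congr pair; exact: val_inj.
  have mg : measurable_fun setT g.
    apply/measurable_fun_pairP; split; first exact: measurable_tnth.
    exact: measurable_behead.
  exists (fun k => g @^-1` (F k `*` G k)).
    apply/seteqP; split => // t _.
    have [i _ Fi] : (\bigcup_k F k) (g t).1 by rewrite -TF.
    have [j _ Gj] : (\bigcup_k G k) (g t).2 by rewrite -TG.
    exists (maxn i j) => //; split.
    - by move: Fi; exact/subsetPset/ndF/leq_maxl.
    - by move: Gj; exact/subsetPset/ndG/leq_maxr.
  move=> k; have [? ?] := Foo k; have [? ?] := Goo k; split.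
    by rewrite -[X in measurable X]setTI; apply: mg => //; exact: measurableX.
  have -> : q (g @^-1` (F k `*` G k)) = p (F k `*` G k).
    rewrite /q /q0 /= /pushforward; congr (p _).
    by apply/seteqP; split => u; rewrite /preimage /mkset gK.
  by rewrite /p /= product_measure1E// lte_mul_pinfty// ge0_fin_numE.
pose Q := Measure_isSigmaFinite.Build _ _ _ (Measure.sort q) qs.
pose q' : {sigma_finite_measure set (n.+1.-tuple T) -> \bar R} :=
  HB.pack (Measure.sort q) Q.
exists q' => A /=.
rewrite /pushforward /product_measure1.
apply: eq_integral => x _; rewrite IH /=; congr (m _).
by apply/seteqP; split => t /=; rewrite /xsection/= inE.
Qed.

Section instances.
Variable n : nat.
Let mu := @borel_lebesgue n.
Let m := projT1 (cid (borel_lebesgue_ex n)).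
Let muE : mu = m. Proof. by apply/funext => A; exact: (projT2 (cid (borel_lebesgue_ex n))). Qed.

Let mu0 : mu set0 = 0. Proof. by rewrite muE measure0. Qed.
Let mu_ge0 A : 0 <= mu A. Proof. by rewrite muE measure_ge0. Qed.
Let mu_sigma_additive : semi_sigma_additive mu.
Proof. by rewrite muE; exact: measure_semi_sigma_additive. Qed.

HB.instance Definition _ := isMeasure.Build _ _ _ mu mu0 mu_ge0 mu_sigma_additive.

Let mu_sigma_finite : sigma_finite setT mu.
Proof. by rewrite muE; exact: sigma_finiteT. Qed.

HB.instance Definition _ :=
  Measure_isSigmaFinite.Build _ _ _ mu mu_sigma_finite.
End instances.

Lemma borel_lebesgue_box n (A : 'I_n -> set R) : (forall i, measurable (A i)) ->
  borel_lebesgue [set t : n.-tuple T | forall i, A i (tnth t i)] =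
  \prod_(i < n) @lebesgue_measure R (A i).
Proof.
elim: n A => [|n IH] A mA.
  rewrite big_ord0 /= diracE mem_set//=; by case.
rewrite big_ord_recl -IH; last by move=> i; exact: mA.
rewrite [LHS]/=.
pose B := borel_lebesgue [set t : n.-tuple T | forall i, A (lift ord0 i) (tnth t i)].
transitivity (\int[@lebesgue_measure R]_x ((\1_(A ord0 : set T) x)%:E * B)); last first.
  rewrite ge0_integralZr//.
  - by rewrite integral_indic ?setIT//; exact: mA.
  - by apply/measurable_EFinP; apply: measurable_indic; exact: mA.
  - exact: measure_ge0.
apply: eq_integral.
move=> x _; rewrite indicE; have [xA|xA] := boolP (x \in A ord0).
  rewrite mul1e; congr borel_lebesgue; apply/seteqP; split => t /= h i.
    by have := h (lift ord0 i); rewrite tnthS.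
  have [j ->|->] := unliftP ord0 i; first by rewrite tnthS; exact: h.
  by move: xA; rewrite inE.
rewrite mul0e (_ : [set t | _] = set0) ?measure0//.
apply/seteqP; split => // t /= /(_ ord0) xA0.
by move/negP: xA; apply; rewrite inE.
Qed.

End borel_lebesgue.

(* Lebesgue measure proper is the completion, so [measurable] on [Rn R n] means
   Lebesgue measurable. *)
Definition Rn (R : realType) (n : nat) :=
  caratheodory_type (mu_ext (@borel_lebesgue R n)).
Definition leb (R : realType) (n : nat) : {measure set (Rn R n) -> \bar R} :=
  @completed_measure_extension _ _ _ (@borel_lebesgue R n).

(* R^n x R^n with its 2n-dimensional Lebesgue sigma-algebra, which is the
   completion of the product sigma-algebra and strictly larger than the product
   of the Lebesgue sigma-algebras. *)
Definition RnRn (R : realType) (n : nat) :=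
  caratheodory_type (mu_ext (@borel_lebesgue R n \x @borel_lebesgue R n)%E).

Section function_space.
Context (R : realType) (n : nat).
Local Notation T := (Rn R n).

Definition meas_fun : set (T -> R) := [set f | measurable_fun setT f].

Definition eucl_ball (c : T) (r : R) : set T :=
  [set x | Num.sqrt (\sum_(i < n) (tnth x i - tnth c i) ^+ 2) < r].

(* ||g||_X for an arbitrary, possibly infinite-valued, function g: the value
   N f if g coincides a.e. with some f in X (N is constant on a.e. classes, so
   the infimum is over a single value), and +oo otherwise (empty infimum). *)
Definition xnorm (X : set (T -> R)) (N : (T -> R) -> R) (g : T -> \bar R) : \bar R :=
  ereal_inf [set (N f)%:E | f in [set f | X f /\
    {ae leb R n, forall x, g x = (f x)%:E}]].

(* Elements of X are functions; a.e. equal functions represent the same element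
   of the quasi-Banach space. *)
Record quasi_banach (X : set (T -> R)) (N : (T -> R) -> R) : Prop := {
  qb_meas : X `<=` meas_fun;
  qb_ae : forall f g, X f -> meas_fun g ->
    {ae leb R n, forall x, f x = g x} -> X g /\ N g = N f;
  qb_zero : X (cst 0);
  qb_add : forall f g, X f -> X g -> X (f \+ g);
  qb_scale : forall (a : R) f, X f -> X (fun x => a * f x);
  qb_ge0 : forall f, X f -> 0 <= N f;
  qb_definite : forall f, X f -> N f = 0 -> {ae leb R n, forall x, f x = 0};
  qb_homogeneous : forall (a : R) f, X f -> N (fun x => a * f x) = `|a| * N f;
  qb_quasi_triangle : exists2 K : R, 1 <= K &
    forall f g, X f -> X g -> N (f \+ g) <= K * (N f + N g);
  qb_complete : forall u : nat -> T -> R, (forall k, X (u k)) ->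
    (forall e : R, 0 < e -> exists k0 : nat, forall j k : nat,
       (k0 <= j)%N -> (k0 <= k)%N -> N (u j \- u k) < e) ->
    exists2 f, X f & (fun k => N (u k \- f)) @ \oo --> (0 : R)
}.

Record ball_quasi_banach (X : set (T -> R)) (N : (T -> R) -> R) : Prop := {
  bqb_quasi_banach : quasi_banach X N;
  bqb_definite : forall f, meas_fun f -> xnorm X N (EFin \o f) = 0%E ->
    {ae leb R n, forall x, f x = 0};
  bqb_lattice : forall f g, meas_fun f -> meas_fun g ->
    {ae leb R n, forall x, `|g x| <= `|f x|} ->
    (xnorm X N (EFin \o g) <= xnorm X N (EFin \o f))%E;
  bqb_fatou : forall (u : nat -> T -> R) f,
    (forall m, meas_fun (u m)) -> meas_fun f ->
    {ae leb R n, forall x, [/\ forall m, 0 <= u m x,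
      {homo (fun m => u m x) : i j / (i <= j)%N >-> i <= j} &
      (fun m => u m x) @ \oo --> f x]} ->
    {homo (fun m => xnorm X N (EFin \o u m)) : i j / (i <= j)%N >-> (i <= j)%E} /\
    (fun m => xnorm X N (EFin \o u m)) @ \oo --> xnorm X N (EFin \o f);
  bqb_ball : forall (c : T) (r : R), 0 < r -> X (\1_(eucl_ball c r))
}.

End function_space.

(* Main.v *)
Require Import Defs.
From HB Require Import structures.
From mathcomp Require Import all_boot all_order all_algebra.
From mathcomp Require Import ring lra.
From mathcomp Require Import all_classical all_reals all_analysis.
From mathcomp Require Import measurable_realfun.
Set Implicit Arguments.
Unset Strict Implicit.
Unset Printing Implicit Defensive.
Import Order.TTheory GRing.Theory Num.Theory.
Import numFieldNormedType.Exports.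
Local Open Scope classical_set_scope.
Local Open Scope ring_scope.

(* A law of large numbers replaces duality. For [g >= 0] bounded and supported
   on a product of sets of finite measure, sample points [y_1, ..., y_m] can be
   chosen greedily so that [sum_i (g (., y_i) - mean)] has squared L2 norm
   [O(m)]; along [m = 2 ^ j] the averages of the [g (., y_i)] then converge a.e.
   to the mean of [g] over [y]. The triangle inequality bounds the norm of each
   average by [sup_y N (g (., y))], and the Fatou property carries this bound to
   the limit. The general case follows by truncation and monotone limits, after
   replacing [|F|] by a Borel function equal to it off a null set. *)

(** * Completion of a sigma-finite measure *)

Section completion.
Context d (T : measurableType d) (R : realType).
Local Open Scope ereal_scope.

(** Covers whose total measure is within [1 / (n + 1)] of the outer measure have measurable unions,
    and the intersection of these unions over [n] is the hull. If the outer measure is infinite, the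
    whole space serves. *)
Lemma mu_ext_measurable_hull (mu : {measure set T -> \bar R}) (A : set T) :
  exists B, [/\ measurable B, A `<=` B & mu B = mu_ext mu A].
Proof.
have [/eqP Aoo|] := boolP (mu_ext mu A == +oo).
  exists setT; split => //; apply/eqP; rewrite eq_le {1}Aoo leey/=.
  by rewrite -(measurable_mu_extE mu)//; exact: le_mu_ext.
rewrite -ltey => Aoo.
have Afin : mu_ext mu A \is a fin_num by rewrite ge0_fin_numE// mu_ext_ge0.
have cover n : exists F : (set T)^nat, measurable_cover A F /\
    \sum_(k <oo) mu (F k) < mu_ext mu A + n.+1%:R^-1%:E.
  have n0 : (0 < n.+1%:R^-1 :> R)%R by rewrite invr_gt0.
  by have [_ [F AF <-] ?] := lb_ereal_inf_adherent n0 Afin; exists F.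
have [F /all_and2[AF muF]] := choice cover.
have mF n : measurable (\bigcup_k F n k).
  by apply: bigcupT_measurable => k; exact: cover_measurable (AF n) k.
have mB : measurable (\bigcap_n \bigcup_k F n k) by exact: bigcapT_measurable.
exists (\bigcap_n \bigcup_k F n k); split => //.
  by move=> x Ax n _; exact: cover_subset (AF n) _ Ax.
apply/eqP; rewrite eq_le; apply/andP; split; last first.
  rewrite -(measurable_mu_extE mu)//; apply: le_mu_ext => x Ax n _.
  exact: cover_subset (AF n) _ Ax.
apply/lee_addgt0Pr => _/posnumP[e]; near \oo => n.
apply: (@le_trans _ _ (mu (\bigcup_k F n k))).
  by apply: le_measure; rewrite ?inE//; exact: bigcap_inf.
apply: (@le_trans _ _ (\sum_(k <oo) mu (F n k))).
  by apply: measure_sigma_subadditive => // k; exact: cover_measurable (AF n) k.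
rewrite (le_trans (ltW (muF n)))// leeD2l// lee_fin ltW//.
by near: n; exact: near_infty_natSinv_lt.
Unshelve. all: by end_near. Qed.

Variable mu : {measure set T -> \bar R}.
Hypothesis mu_sfin : sigma_finite setT mu.

(** Cut [A] along a sigma-finite exhaustion [F]. The piece of [A] in [F i] has finite outer measure,
    so it can be cancelled in the Caratheodory identity tested on its hull [B i]: the excess of
    [B i] over the piece has outer measure 0, hence a null hull. *)
Lemma caratheodory_outer_approx (A : set T) :
  (mu_ext mu).-cara.-measurable A ->
  exists B, [/\ measurable B, A `<=` B & mu.-negligible (B `\` A)].
Proof.
move=> mA; have /sigma_finiteP[F [TF _ /all_and2[mF Foo]]] := mu_sfin.
have hull i := mu_ext_measurable_hull mu (A `&` F i).
have [B /all_and3[mB AB muB]] := choice hull.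
exists (\bigcup_i B i); split; first exact: bigcupT_measurable.
  move=> x Ax; have [i _ Fix] : (\bigcup_i F i) x by rewrite -TF.
  by exists i => //; apply: AB.
suff : mu.-negligible (\bigcup_i (B i `\` (A `&` F i))).
  apply: negligibleS => x [[i _ Bix] nAx]; exists i => //; split => //.
  by case.
apply: negligible_bigcup => i.
have mAF : (mu_ext mu).-cara.-measurable (A `&` F i).
  by apply: measurableI => //; exact: caratheodory_measurable_mu_ext.
have [Z [mZ BZ Z0]] := mu_ext_measurable_hull mu (B i `\` (A `&` F i)).
exists Z; split => //; rewrite Z0.
have AFfin : mu_ext mu (A `&` F i) \is a fin_num.
  rewrite ge0_fin_numE ?mu_ext_ge0//.
  apply: (@le_lt_trans _ _ (mu (F i))); last exact: Foo.
  rewrite -(measurable_mu_extE mu (mF i)).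
  by apply: le_mu_ext; exact: subIsetr.
have /= := mAF (B i).
rewrite measurable_mu_extE// muB -setDE (setIidr (AB i)) => muBE.
apply/eqP; rewrite eq_le; apply/andP; split; last first.
  exact: mu_ext_ge0.
rewrite -(leeD2lE _ _ AFfin) adde0.
by rewrite [leRHS]muBE.
Qed.

Lemma caratheodory_inner_approx (A : set T) :
  (mu_ext mu).-cara.-measurable A ->
  exists B, [/\ measurable B, B `<=` A & mu.-negligible (A `\` B)].
Proof.
move=> mA; have [|B [mB AB nB]] := @caratheodory_outer_approx (~` A).
  exact: measurableC.
exists (~` B); split.
- exact: measurableC.
- by rewrite -[A]setCK; exact: subsetC.
- by apply: negligibleS nB => x [Ax /contrapT Bx]; split => // /(_ Ax).
Qed.

(** There are countably many rational superlevel sets, so the parts missed by their inner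
    approximations [B n] lie in a single null set [Z]. Off [Z], every superlevel set of [f] is a
    countable union of sets [B n]. *)
Lemma caratheodory_measurable_fun (D : set T) (f : T -> R) :
  measurable D ->
  measurable_fun (D : set (caratheodory_type (mu_ext mu)))
    (f : caratheodory_type (mu_ext mu) -> R) ->
  exists Z, [/\ measurable Z, mu Z = 0 & measurable_fun (D `\` Z) f].
Proof.
move=> mD mf.
have mDc : (mu_ext mu).-cara.-measurable D.
  exact: caratheodory_measurable_mu_ext.
(* Codes of no rational are sent to 0, so [q_] is total and still hits every rational. *)
have [q_ q_K] : exists q_ : nat -> rat, forall q, q_ (pickle q) = q.
  by exists (fun k => odflt 0%Q (unpickle k)) => q; rewrite pickleK.
have level n : exists B, [/\ measurable B,
    B `<=` D `&` f @^-1` `](ratr (q_ n) : R), +oo[ &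
    mu.-negligible ((D `&` f @^-1` `](ratr (q_ n) : R), +oo[) `\` B)].
  apply: caratheodory_inner_approx.
  by apply: mf => //; exact: measurable_itv.
have [B /all_and3[mB BD nB]] := choice level.
have [Z [mZ Z0 BZ]] := negligible_bigcup nB.
exists Z; split => //.
apply: (measurability _ (RGenOInfty.measurableE R)) => //.
move=> _ [_ [r ->] <-].
rewrite (_ : _ `&` _ =
    \bigcup_(n in [set n | r <= ratr (q_ n)]%R) (B n `\` Z)).
  apply: bigcup_measurable => n _; exact: measurableD.
apply/seteqP; split=> x /=.
  rewrite in_itv/= andbT => -[[Dx nZx] rfx].
  have [q] := rat_in_itvoo rfx; rewrite in_itv/= => /andP[rq qfx].
  exists (pickle q); first by rewrite /= q_K ltW.
  split => //; apply: contrapT => nBx; apply/nZx/BZ; exists (pickle q) => //.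
  by split => //; split => //=; rewrite in_itv/= andbT q_K.
move=> [n /= rn [/BD[Dx] /= fx nZx]]; split => //.
move: fx; rewrite !in_itv/= !andbT; exact: le_lt_trans.
Qed.

End completion.

Lemma sigma_finite_product d1 d2 (T1 : measurableType d1)
    (T2 : measurableType d2) (R : realType)
    (m1 : {sigma_finite_measure set T1 -> \bar R})
    (m2 : {sigma_finite_measure set T2 -> \bar R}) :
  sigma_finite setT (m1 \x m2)%E.
Proof.
have /sigma_finiteP[F [TF ndF Foo]] := sigma_finiteT m1.
have /sigma_finiteP[G [TG ndG Goo]] := sigma_finiteT m2.
exists (fun k => F k `*` G k).
  apply/seteqP; split => // -[x y] _.
  have [i _ Fix] : (\bigcup_k F k) x by rewrite -TF.
  have [j _ Gjy] : (\bigcup_k G k) y by rewrite -TG.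
  exists (maxn i j) => //; split.
  - by move: Fix; exact/subsetPset/ndF/leq_maxl.
  - by move: Gjy; exact/subsetPset/ndG/leq_maxr.
move=> k; have [? ?] := Foo k; have [? ?] := Goo k; split.
  exact: measurableX.
by rewrite product_measure1E// lte_mul_pinfty// ge0_fin_numE.
Qed.

(** * Sampling *)

Lemma bounded_ge0_integrable d (T : measurableType d) (R : realType)
    (m : {finite_measure set T -> \bar R}) (u : T -> R) (M : R) :
  measurable_fun setT u -> (forall y, 0 <= u y <= M) ->
  m.-integrable setT (EFin \o u).
Proof.
move=> mu uM; apply: measurable_bounded_integrable => //.
  by rewrite ltey_eq fin_num_measure.
exists M; split; first exact: num_real.
move=> B /ltW MB y _; have /andP[u0 uM'] := uM y.
by rewrite /= ger0_norm// (le_trans uM').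
Qed.

(** With [c] the mass of [m] and [e] the mean of [u], centering kills the cross term: the left side
    equals [c * (a ^+ 2 - e ^+ 2)] plus the integral of [u ^+ 2], which is at most [c * M ^+ 2]. *)
Lemma integral_sqr_centered_le d (T : measurableType d) (R : realType)
    (m : {finite_measure set T -> \bar R}) (u : T -> R) (M a : R) :
  measurable_fun setT u -> (forall y, 0 <= u y <= M) -> (0 < m setT)%E ->
  (\int[m]_y ((a + (u y - (fine (m setT))^-1 * \int[m]_z u z)%R) ^+ 2)%:E <=
   (fine (m setT) * (a ^+ 2 + M ^+ 2))%:E)%E.
Proof.
move=> mu uM m0; set c := fine (m setT); set e := c^-1 * _.
have mT : m setT = c%:E by rewrite fineK// fin_num_measure.
have c0 : 0 < c by rewrite -lte_fin -mT.
have M0 : 0 <= M.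
  by have /andP[/le_trans] := uM point; apply.
have iu := bounded_ge0_integrable m mu uM.
have mu2 : measurable_fun setT (fun y => u y ^+ 2) by exact: measurable_funX.
have uM2 y : 0 <= u y ^+ 2 <= M ^+ 2.
  by have /andP[u0 uMy] := uM y; rewrite sqr_ge0 lerXn2r// nnegrE.
have iu2 := bounded_ge0_integrable m mu2 uM2.
have ic r : m.-integrable setT (EFin \o cst r).
  by apply: finite_measure_integrable_cst.
have iZ r : m.-integrable setT (EFin \o (fun y => r * u y)).
  exact: (integrableZl measurableT r iu).
have iD : m.-integrable setT (EFin \o (fun y => 2 * (a - e) * u y + u y ^+ 2)).
  exact: (integrableD measurableT (iZ _) iu2).
have -> : (\int[m]_y ((a + (u y - e)%R) ^+ 2)%:E =
    (\int[m]_y ((a - e) ^+ 2 + (2 * (a - e) * u y + u y ^+ 2)))%R%:E)%E.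
  rewrite /Rintegral fineK.
    by apply: eq_integral => y _; congr EFin; ring.
  apply: integrable_fin_num => //.
  exact: (integrableD measurableT (ic _) iD).
rewrite lee_fin (RintegralD measurableT (ic _) iD).
rewrite (RintegralD measurableT (iZ _) iu2) (RintegralZl _ measurableT iu).
rewrite Rintegral_cst// -/c.
have -> : \int[m]_y u y = c * e by rewrite /e mulrA divff ?mul1r// gt_eqF.
have : \int[m]_y (u y ^+ 2) <= M ^+ 2 * c.
  rewrite -Rintegral_cst//; apply: le_Rintegral => //; first exact: ic.
  move=> y _.
  by have /andP[] := uM2 y.
have : 0 <= c * e ^+ 2 by rewrite mulr_ge0 ?sqr_ge0// ltW.
rewrite [X in X * c + _](_ : _ = (a - e) ^+ 2)//.
by lra.
Qed.

Section sampling.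
Context d1 d2 (T1 : measurableType d1) (T2 : measurableType d2) (R : realType).
Variables (m1 : {finite_measure set T1 -> \bar R}).
Variables (m2 : {finite_measure set T2 -> \bar R}).
Variables (f : T1 * T2 -> R) (M : R).
Hypothesis mf : measurable_fun setT f.
Hypothesis fM : forall p, 0 <= f p <= M.
Hypothesis m2_gt0 : (0 < m2 setT)%E.

Let c := fine (m2 setT).
Let g x := c^-1 * \int[m2]_y f (x, y).
Let C := M ^+ 2 * fine (m1 setT) + 1.

Let m1T : m1 setT = (fine (m1 setT))%:E.
Proof. by rewrite fineK// fin_num_measure. Qed.

Let m2T : m2 setT = c%:E.
Proof. by rewrite fineK// fin_num_measure. Qed.

Let c_gt0 : 0 < c.
Proof. by rewrite -lte_fin -m2T. Qed.

Let mf1 y : measurable_fun setT (fun x => f (x, y)).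
Proof. exact: measurableT_comp. Qed.

Let mf2 x : measurable_fun setT (fun y => f (x, y)).
Proof. exact: measurableT_comp. Qed.

Let mg : measurable_fun setT g.
Proof.
apply: measurable_funM => //; apply: measurableT_comp => //.
apply: (measurable_fun_fubini_tonelli_F (EFin \o f)).
  exact/measurable_EFinP.
by move=> p; rewrite lee_fin; have /andP[] := fM p.
Qed.

Let dev (s : seq T2) x := \sum_(y <- s) (f (x, y) - g x).

Let mdev s : measurable_fun setT (dev s).
Proof. by apply: measurable_sum => y; exact: measurable_funB. Qed.

(* The deviations [f (x, y) - g x] have mean zero in [y], so on average over [y]
   adding one sample point increases the squared L2 norm of [dev] by at most
   [M ^+ 2 * m1 setT]. *)
Let dev_cons (W : set T2) (s : seq T2) (r : R) : measurable W ->
  m2 (~` W) = 0%E ->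
  (\int[m1]_x (dev s x ^+ 2)%:E <= r%:E)%E ->
  exists2 y, W y & (\int[m1]_x (dev (y :: s) x ^+ 2)%:E <= (r + C)%:E)%E.
Proof.
move=> mW W0 sr; apply: contrapT => /forall2NP noy.
pose H (p : T1 * T2) := (((dev s p.1 + (f p - g p.1)) ^+ 2)%:E)%E.
have mH : measurable_fun setT H.
  apply/measurable_EFinP/measurable_funX/measurable_funD.
    exact: measurableT_comp.
  by apply: measurable_funB => //; exact: measurableT_comp.
have H0 p : (0 <= H p)%E by rewrite lee_fin sqr_ge0.
have HE y : (\int[m1]_x (dev (y :: s) x ^+ 2)%:E = \int[m1]_x H (x, y))%E.
  by apply: eq_integral => x _; rewrite /dev big_cons addrC.
have : (\int[m2]_y \int[m1]_x H (x, y) <=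
    (c * (r + M ^+ 2 * fine (m1 setT)))%:E)%E.
  (* Integrating first in [y] lets the centering act for each fixed [x]. *)
  rewrite -fubini_tonelli//.
  apply: (@le_trans _ _ (\int[m1]_x (c * (dev s x ^+ 2 + M ^+ 2))%:E)%E).
    apply: ge0_le_integral => //.
    - by move=> x _; exact: integral_ge0.
    - exact: measurable_fun_fubini_tonelli_F.
    - apply/measurable_EFinP/measurable_funM => //.
      apply: measurable_funD => //.
      exact: measurable_funX.
    - move=> x _; apply: (@integral_sqr_centered_le _ _ _ m2
        (fun y => f (x, y)) M (dev s x)) => //.
  under eq_integral do rewrite EFinM.
  rewrite ge0_integralZl//=; last 3 first.
  - apply/measurable_EFinP; apply: measurable_funD => //.
    exact: measurable_funX.
  - by move=> x _; rewrite lee_fin addr_ge0// sqr_ge0.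
  - by rewrite lee_fin ltW.
  under eq_integral do rewrite EFinD.
  rewrite ge0_integralD//=; last 3 first.
  - by move=> x _; rewrite lee_fin sqr_ge0.
  - exact/measurable_EFinP/measurable_funX.
  - by move=> x _; rewrite lee_fin sqr_ge0.
  rewrite integral_cst// [leRHS]EFinM lee_pmul2l//= [leRHS]EFinD leeD//.
  by rewrite [leRHS]EFinM -m1T.
apply/negP; rewrite -ltNge.
have r0 : 0 <= r.
  rewrite -lee_fin (le_trans _ sr)// integral_ge0// => x _.
  by rewrite lee_fin sqr_ge0.
have rC0 : 0 <= r + C.
  by rewrite addr_ge0// /C addr_ge0// mulr_ge0 ?sqr_ge0// fine_ge0.
(* If every [y] in [W] failed, the integral over [y] would be at least [(r + C) * c]. The summand 1
   in [C] makes this strictly larger than the bound just obtained. *)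
apply: (@lt_le_trans _ _ (\int[m2]_y (r + C)%:E)%E).
  rewrite integral_cst// [ltRHS](_ : _ = ((r + C) * c)%:E).
    by rewrite lte_fin mulrC ltr_pM2r// /C addrA ltrDl.
  by rewrite EFinM -m2T.
apply: ae_ge0_le_integral => //.
- by move=> y _; exact: integral_ge0.
- exact: measurable_fun_fubini_tonelli_G.
- exists (~` W); split => //; first exact: measurableC.
  move=> y /= nle Wy; apply: nle => _; rewrite -HE ltW// ltNge.
  by apply/negP; have [] := noy y.
Qed.

Let samples (W : set T2) (n : nat) : measurable W -> m2 (~` W) = 0%E ->
  exists s : seq T2, [/\ size s = n, forall y, y \in s -> W y &
    (\int[m1]_x (dev s x ^+ 2)%:E <= (n%:R * C)%:E)%E].
Proof.
move=> mW W0; elim: n => [|n [s [sn sW sr]]].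
  exists [::]; split => //; rewrite mul0r integral0_eq// => x _.
  by rewrite /dev big_nil expr0n.
have [y Wy yr] := dev_cons mW W0 sr.
exists (y :: s); split => //=; first by rewrite sn.
  by move=> z; rewrite inE => /predU1P[->//|/sW].
by rewrite -natr1 mulrDl mul1r.
Qed.

(** The average of [2 ^ j] deviations has squared L2 norm at most [C / 2 ^ j], which is summable in
    [j], whereas [C / m] over all sample sizes [m] is not. So the sum of the squares is integrable,
    hence finite a.e., and its terms tend to 0. The set [W] of full measure keeps the samples where
    a norm bound is known. *)
Lemma sampling (W : set T2) : measurable W -> m2 (~` W) = 0%E ->
  exists s : nat -> seq T2, [/\ forall j, size (s j) = (2 ^ j)%N,
    forall j y, y \in s j -> W y &
    {ae m1, forall x, (2 ^ j)%:R^-1 * \sum_(y <- s j) f (x, y) @[j --> \oo] -->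
      (fine (m2 setT))^-1 * \int[m2]_y f (x, y)}].
Proof.
move=> mW W0.
have [s /all_and3[ss sW sC]] := choice (fun j => samples (2 ^ j) mW W0).
exists s; split => //; rewrite -/c.
pose a j x : R := (2 ^ j)%:R^-1 * dev (s j) x.
have ma j : measurable_fun setT (a j) by exact: measurable_funM.
have aE x j : a j x = (2 ^ j)%:R^-1 * (\sum_(y <- s j) f (x, y)) - g x.
  rewrite /a /dev sumrB mulrBr; congr (_ - _).
  rewrite big_const_seq count_predT ss iter_addr_0 -[g x *+ _]mulr_natl.
  by rewrite mulrA mulVf ?mul1r// pnatr_eq0 expn_eq0.
have C0 : 0 <= C by rewrite /C addr_ge0// mulr_ge0 ?sqr_ge0// fine_ge0.
(* The bound [C / 2 ^ j] is written in the form that [epsilon_trick0] sums, with total at most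
   [2 * C]. *)
have a2 j : (\int[m1]_x (a j x ^+ 2)%:E <= ((2 * C) / (2 ^ j.+1)%:R)%:E)%E.
  under eq_integral do rewrite /a exprMn EFinM.
  rewrite ge0_integralZl//=; last 2 first.
  - exact/measurable_EFinP/measurable_funX.
  - by move=> x _; rewrite lee_fin sqr_ge0.
  apply: (@le_trans _ _ (((2 ^ j)%:R^-1 ^+ 2)%:E * ((2 ^ j)%:R * C)%:E)%E).
    by apply: lee_wpmul2l => //; rewrite lee_fin sqr_ge0.
  rewrite -EFinM lee_fin expnS natrM le_eqVlt; apply/orP; left; apply/eqP.
  field.
  by rewrite pnatr_eq0 expn_eq0.
have ma2 j : measurable_fun setT (fun x => (a j x ^+ 2)%:E).
  exact/measurable_EFinP/measurable_funX.
have a20 j x : (0 <= (a j x ^+ 2)%:E)%E by rewrite lee_fin sqr_ge0.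
have sum_lty : (\int[m1]_x \sum_(j <oo) (a j x ^+ 2)%:E < +oo)%E.
  rewrite integral_nneseries//.
  apply: (@le_lt_trans _ _ (2 * C)%:E); last exact: ltry.
  apply: (@le_trans _ _ (\sum_(j <oo) ((2 * C) / (2 ^ j.+1)%:R)%:E)%E).
    by apply: lee_nneseries => j *; [exact: integral_ge0|exact: a2].
  by apply: epsilon_trick0; rewrite mulr_ge0.
have /integrable_ae :
    m1.-integrable setT (fun x => \sum_(j <oo) (a j x ^+ 2)%:E)%E.
  apply/integrableP; split.
    exact: ge0_emeasurable_sum.
  under eq_integral => x _ do rewrite gee0_abs ?nneseries_ge0//.
  exact: sum_lty.
move=> /(_ measurableT); apply: filterS => x /(_ I).
rewrite ge0_fin_numE ?nneseries_ge0// => xlty.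
have tail0 := nneseries_tail_cvg xlty (fun j _ => a20 j x).
have a2cvg : (a j x ^+ 2)%:E @[j --> \oo] --> 0%E.
  apply: squeeze_cvge tail0; last exact: cvg_cst.
  apply: nearW => j; rewrite a20/=.
  have := @nneseries_lim_ge R (fun j => (a j x ^+ 2)%:E) xpredT j j.+1
    (fun j _ _ => a20 j x).
  by rewrite big_nat1.
have {a2cvg}/fine_cvgP[_ /cvgrPdist_lt a2cvg] := a2cvg.
apply/cvgrPdist_lt => e e0; have := a2cvg (e ^+ 2) (exprn_gt0 2 e0).
apply: filterS => j /=; rewrite sub0r normrN ger0_norm ?sqr_ge0//.
rewrite aE -real_normK ?num_real// distrC -/(g x).
by rewrite ltr_pXn2r// ?nnegrE// ltW.
Qed.
End sampling.

(** * The norm of [X] *)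

Section xnorm.
Context (R : realType) (n : nat).
Variables (X : set (Rn R n -> R)) (N : (Rn R n -> R) -> R).

Lemma xnorm_ae_eq (g h : Rn R n -> \bar R) :
  {ae leb R n, forall x, g x = h x} -> xnorm X N g = xnorm X N h.
Proof.
move=> gh; rewrite /xnorm; congr ereal_inf.
apply/seteqP; split => _ [f [Xf fE] <-]; exists f => //; split => //;
  by apply: filterS2 gh fE => x -> ->.
Qed.

Hypothesis hX : ball_quasi_banach X N.
Let qX := bqb_quasi_banach hX.

Lemma xnorm_ge0 (g : Rn R n -> \bar R) : (0 <= xnorm X N g)%E.
Proof.
by apply: le_ereal_inf_tmp => _ [f [Xf _] <-]; rewrite lee_fin (qb_ge0 qX).
Qed.

Lemma xnormE (f : Rn R n -> R) : X f -> xnorm X N (EFin \o f) = (N f)%:E.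
Proof.
move=> Xf; apply/eqP; rewrite eq_le; apply/andP; split.
  by apply: ereal_inf_lbound; exists f => //; split => //; exact: aeW.
apply: le_ereal_inf_tmp => _ [h [Xh hE] <-]; rewrite lee_fin.
have [|_ ->//] := qb_ae qX Xf (qb_meas qX Xh).
by apply: filterS hE => x [].
Qed.

Lemma xnorm_lty (f : Rn R n -> R) : measurable_fun setT f ->
  (xnorm X N (EFin \o f) < +oo)%E -> X f.
Proof.
move=> mf /ereal_inf_lt[_ [h [Xh hE] _] _].
suff [] : X f /\ N f = N h by [].
by apply: (qb_ae qX) => //; apply: filterS hE => x [] ->.
Qed.

(** Here [g] may take infinite values. If it has no representative in [X], the right side is an
    empty infimum, that is [+oo]; otherwise the lattice property applies to a representative. *)
Lemma xnorm_le (f : Rn R n -> R) (g : Rn R n -> \bar R) :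
  measurable_fun setT f ->
  {ae leb R n, forall x, (`|f x|%:E <= `|g x|)%E} ->
  (xnorm X N (EFin \o f) <= xnorm X N g)%E.
Proof.
move=> mf fg; apply: le_ereal_inf_tmp => _ [h [Xh gh] <-].
rewrite -xnormE//; apply: (bqb_lattice hX); [exact: (qb_meas qX)|exact: mf|].
by apply: filterS2 fg gh => x + gE; rewrite gE.
Qed.

Lemma N_cst0 : N (cst 0) = 0.
Proof.
have := qb_homogeneous qX 0 (qb_zero qX).
rewrite normr0 mul0r => N0; rewrite -[RHS]N0; congr N.
by apply/funext => x /=; rewrite mul0r.
Qed.

Lemma X_sum (I : eqType) (s : seq I) (u : I -> Rn R n -> R) (S : R) :
  (forall f g, X f -> X g -> N (f \+ g) <= N f + N g) ->
  (forall i, i \in s -> X (u i) /\ N (u i) <= S) ->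
  X (fun x => \sum_(i <- s) u i x) /\
  N (fun x => \sum_(i <- s) u i x) <= (size s)%:R * S.
Proof.
move=> triangle; elim: s => [|i s IH] us.
  rewrite (_ : (fun x => _) = cst 0); last first.
    by apply/funext => x; rewrite big_nil.
  by rewrite N_cst0 mul0r; split => //; exact: qb_zero qX.
have [Xi Ni] := us i (mem_head _ _).
have [|Xs Ns] := IH; first by move=> j js; apply: us; rewrite inE js orbT.
rewrite (_ : (fun x => _) = u i \+ (fun x => \sum_(i <- s) u i x)); last first.
  by apply/funext => x; rewrite big_cons.
split; first exact: (qb_add qX).
by rewrite (le_trans (triangle _ _ Xi Xs))//= -nat1r mulrDl mul1r lerD.
Qed.

(** The Fatou property concerns monotone sequences, so it is applied to the tail infima [v k], which
    lie below [u k] and increase to [f] a.e. *)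
Lemma xnorm_lim_le (u : nat -> Rn R n -> R) (f : Rn R n -> R) (a : \bar R) :
  (forall k, measurable_fun setT (u k)) -> measurable_fun setT f ->
  (forall k x, 0 <= u k x) ->
  {ae leb R n, forall x, u k x @[k --> \oo] --> f x} ->
  (forall k, (xnorm X N (EFin \o u k) <= a)%E) ->
  (xnorm X N (EFin \o f) <= a)%E.
Proof.
move=> mu mf u0 uf ua.
have lb x : has_lbound (range (u ^~ x)) by exists 0 => _ [k _ <-].
pose v k x := infs (u ^~ x) k.
have v0 k x : 0 <= v k x.
  by apply: lb_le_inf; [exists (u k x); exists k => /=|move=> _ [j _ <-]].
have vu k x : v k x <= u k x.
  apply: ge_inf; last by exists k => /=.
  exact: has_lbound_sdrop.
have mv k : measurable_fun setT (v k) by apply: measurable_fun_infs.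
have [_ vcvg] : {homo (fun m => xnorm X N (EFin \o v m)) :
      i j / (i <= j)%N >-> (i <= j)%E} /\
    (fun m => xnorm X N (EFin \o v m)) @ \oo --> xnorm X N (EFin \o f).
  apply: (bqb_fatou hX) => //; apply: filterS uf => x ux; split => //.
    exact: nondecreasing_infs.
  exact: cvg_infs.
rewrite -(cvg_lim _ vcvg)//; apply: lime_le.
  by apply/cvg_ex; eexists; exact: vcvg.
apply: nearW => k; apply: le_trans (ua k).
apply: (bqb_lattice hX); [exact: mu|exact: mv|].
by apply: aeW => x; rewrite !ger0_norm.
Qed.

(* The set where [u k] tends to [+oo] carries, for every [m], the function
   [m * \1_A] of norm at most [a], so [\1_A] has norm 0. *)
Lemma xnorm_nd_lim_le (u : nat -> Rn R n -> R) (g : Rn R n -> \bar R)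
    (a : \bar R) :
  (forall k, measurable_fun setT (u k)) ->
  (forall k x, 0 <= u k x) ->
  (forall x, {homo u ^~ x : i j / (i <= j)%N >-> i <= j}) ->
  {ae leb R n, forall x, (u k x)%:E @[k --> \oo] --> g x} ->
  (forall k, (xnorm X N (EFin \o u k) <= a)%E) ->
  (xnorm X N g <= a)%E.
Proof.
move=> mu u0 ndu ug ua.
have [->|aoo] := eqVneq a +oo%E; first exact: leey.
have a0 : (0 <= a)%E := le_trans (xnorm_ge0 _) (ua 0%N).
have afin : a \is a fin_num by rewrite ge0_fin_numE// ltey.
pose A := \bigcap_(m : nat) \bigcup_k [set x | m%:R < u k x].
have mA : measurable A.
  apply: bigcapT_measurable => m; apply: bigcupT_measurable => k.
  have := mu k measurableT _ (measurable_itv `]m%:R, +oo[); rewrite setTI.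
  by congr measurable; apply/seteqP; split => x /=; rewrite in_itv/= andbT.
have mA1 : measurable_fun setT (\1_A : Rn R n -> R) by exact: measurable_indic.
have mw k (m : nat) :
    measurable_fun setT (fun x => Num.min (u k x) m%:R * \1_A x).
  apply: (measurable_funM _ mA1); apply: (measurable_minr (mu k)).
  exact: measurable_cst.
(* On [A] the truncations of [u k] at height [m] are eventually equal to [m], so [m * \1_A] is a
   limit of functions dominated by the [u k]. *)
have Am (m : nat) : (xnorm X N (EFin \o (fun x => m%:R * \1_A x)%R) <= a)%E.
  apply: (@xnorm_lim_le (fun k x => Num.min (u k x) m%:R * \1_A x)).
  - by move=> k; exact: mw.
  - exact: measurable_funM.
  - by move=> k x; rewrite mulr_ge0// ?indicE// le_min u0/=.
  - apply: aeW => x; rewrite indicE; have [|xA] := boolP (x \in A); last first.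
      rewrite mulr0 (_ : (fun k => _) = cst 0); first exact: cvg_cst.
      by apply/funext => k; rewrite mulr0.
    rewrite inE => /(_ m I)[k _ /= mk].
    apply: cvg_near_cst; exists k => // j /= kj.
    by rewrite min_r// (le_trans (ltW mk))// ndu.
  - move=> k; apply: le_trans (ua k).
    apply: (bqb_lattice hX); [exact: mu|exact: mw|].
    apply: aeW => x; rewrite normrM (ger0_norm (u0 k x)).
    rewrite ger0_norm ?le_min ?u0//= indicE; case: (x \in A) => /=.
      by rewrite normr1 mulr1 ge_min lexx.
    by rewrite normr0 mulr0.
have XA : X (\1_A).
  apply: xnorm_lty => //.
  rewrite (_ : EFin \o _ = EFin \o (fun x => 1%:R * \1_A x)%R).
    by rewrite (le_lt_trans (Am 1%N))// ltey.
  by apply/funext => x /=; rewrite mul1r.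
have NA : N (\1_A) = 0.
  apply/eqP; rewrite eq_le (qb_ge0 qX)// andbT leNgt; apply/negP => NA0.
  have [m am] : exists m : nat, fine a < m%:R * N (\1_A).
    exists (Num.truncn (fine a / N (\1_A))).+1.
    by rewrite -ltr_pdivrMr// truncnS_gt.
  have := Am m; rewrite xnormE; last exact: (qb_scale qX).
  rewrite (qb_homogeneous qX)// ger0_norm// -(fineK afin) lee_fin leNgt.
  by rewrite am.
have A0 : {ae leb R n, forall x, ~ A x}.
  apply: filterS (qb_definite qX XA NA) => x; rewrite indicE => xA0 Ax.
  by move: xA0; rewrite mem_set//= => /eqP; rewrite oner_eq0.
(* Setting [u k] to 0 on the null set [A] makes the limit finite everywhere, so a real-valued [f]
   can replace [g]. *)
pose v k x := u k x * \1_(~` A) x.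
have mv k : measurable_fun setT (v k).
  exact: (measurable_funM (mu k) (measurable_indic (measurableC mA))).
have vcvg x : cvgn (v ^~ x).
  rewrite /v indicE; have [|xA] := boolP (x \in ~` A); last first.
    rewrite (_ : (fun k => _) = cst 0); first exact: is_cvg_cst.
    by apply/funext => k; rewrite mulr0.
  rewrite inE => nAx; apply: nondecreasing_is_cvgn.
    by move=> i j ij; rewrite !mulr1 ndu.
  have [m nm] : exists m : nat, forall k, ~ (m%:R < u k x).
    apply: contrapT => /forallNP nm; apply: nAx => m _.
    by have /existsNP[k /contrapT mk] := nm m; exists k.
  exists m%:R => _ [k _ <-]; rewrite mulr1 leNgt; exact/negP.
pose f x := limn (v ^~ x).
have mf : measurable_fun setT f.
  apply: (@measurable_fun_cvg _ _ _ _ v) => //.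
rewrite (_ : xnorm X N g = xnorm X N (EFin \o f)); last first.
  apply: xnorm_ae_eq; apply: filterS2 ug A0 => x ux nAx.
  apply: (cvg_unique _ ux) => //=.
  rewrite (_ : (fun k => _) = (fun k => (v k x)%:E)).
    by apply: cvg_EFin; [exact: nearW|exact: vcvg].
  by apply/funext => k; rewrite /v indicE mem_set// mulr1.
apply: (@xnorm_lim_le v) => //.
- by move=> k x; rewrite mulr_ge0// indicE.
- by apply: aeW => x; exact: vcvg.
- move=> k; apply: le_trans (ua k).
  apply: (bqb_lattice hX); [exact: mu|exact: mv|].
  apply: aeW => x; rewrite /v normrM indicE; case: (x \in _).
    by rewrite normr1 mulr1.
  by rewrite normr0 mulr0.
Qed.

End xnorm.

(** * Borel and Lebesgue measurability *)

Section completion_transfer.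
Context d (T : measurableType d) (R : realType).
Variable mu : {measure set T -> \bar R}.
Local Notation cT := (caratheodory_type (mu_ext mu)).
Local Notation cmu := (@completed_measure_extension _ _ _ mu).

Lemma caratheodory_measurable_fun_sub d' (U : measurableType d') (D : set T)
    (f : T -> U) : measurable D ->
  measurable_fun D f -> measurable_fun (D : set cT) (f : cT -> U).
Proof.
by move=> mD mf _ Y mY; apply: caratheodory_measurable_mu_ext; exact: mf.
Qed.

Lemma completion_negligible (A : set T) :
  mu.-negligible A -> cmu.-negligible (A : set cT).
Proof.
move=> [Z [mZ Z0 AZ]]; exists Z; split => //.
  exact: caratheodory_measurable_mu_ext.
by rewrite /= /completed_measure_extension measurable_mu_extE.
Qed.

(** The identity map, from the completed sigma-algebra to the original one, is measurable and pushes
    the completed measure forward to [mu]. *)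
Lemma ge0_integral_completion (D : set T) (f : T -> \bar R) : measurable D ->
  measurable_fun D f -> (forall x, 0 <= f x)%E ->
  (\int[cmu]_(x in (D : set cT)) (f : cT -> _) x = \int[mu]_(x in D) f x)%E.
Proof.
move=> mD mf f0.
have mid : measurable_fun (setT : set cT) (idfun : cT -> T).
  apply: (caratheodory_measurable_fun_sub measurableT).
  exact: (@measurable_id _ T setT).
have := ge0_integral_pushforward mid cmu mD mf (fun x _ => f0 x).
rewrite preimage_id => /= <-; apply: eq_measure_integral => A mA _.
rewrite /= /pushforward preimage_id /completed_measure_extension /=.
by rewrite measurable_mu_extE.
Qed.

End completion_transfer.

(** * Restriction of a measure to a set of finite measure *)

Section mfrestr.
Context d (T : measurableType d) (R : realType).
Variables (mu : {measure set T -> \bar R}) (D : set T).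
Hypotheses (mD : measurable D) (Doo : (mu D < +oo)%E).

Lemma ae_mfrestr (P : T -> Prop) :
  {ae mfrestr mD Doo, forall x, P x} -> {ae mu, forall x, D x -> P x}.
Proof.
move=> [A [mA A0 PA]]; exists (A `&` D); split => //; first exact: measurableI.
move=> x /= /not_implyP[Dx nPx]; split => //; exact: PA.
Qed.

Lemma ge0_integral_mfrestr (f : T -> \bar R) : measurable_fun setT f ->
  (forall x, 0 <= f x)%E ->
  (\int[mfrestr mD Doo]_x f x = \int[mu]_(x in D) f x)%E.
Proof.
move=> mf f0; rewrite [LHS](@ge0_negligible_integral _ _ _ _ _ (~` D))//.
- rewrite setTD setCK; apply: eq_measure_integral => A mA AD.
  by rewrite /= /mfrestr /mrestr setIidl.
- exact: measurableC.
- by rewrite /= /mfrestr /mrestr setICl measure0.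
Qed.

End mfrestr.

(** * The bounded case: sampling and the triangle inequality *)

Section bounded_case.
Context (R : realType) (n : nat).
Variables (X : set (Rn R n -> R)) (N : (Rn R n -> R) -> R).
Hypothesis hX : ball_quasi_banach X N.
Hypothesis triangle : forall f g, X f -> X g -> N (f \+ g) <= N f + N g.
Let qX := bqb_quasi_banach hX.
Local Notation B := (n.-tuple (measurableTypeR R)).
Local Notation b := (@borel_lebesgue R n).

(** Restriction to [A] and [C] gives the two finite measures for [sampling], with all samples in
    [C]. The averages scaled by [b C] tend to the integral a.e.; each has norm at most [b C * S] by
    the triangle inequality, and [xnorm_lim_le] passes to the limit. *)
Lemma xnorm_integral_bounded_le (A C : set B) (g : B * B -> R) (M : R)
    (S : \bar R) :
  measurable A -> (b A < +oo)%E -> measurable C -> (b C < +oo)%E ->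
  measurable_fun setT g -> (forall p, 0 <= g p <= M) ->
  (forall x y, g (x, y) != 0 -> A x /\ C y) ->
  (forall y, C y -> xnorm X N (fun x => (g (x, y))%:E) <= S)%E ->
  (xnorm X N (EFin \o (fun x : Rn R n => \int[b]_y g (x, y))%R) <= b C * S)%E.
Proof.
move=> mA Aoo mC Coo mg gM gAC gS.
have g0 p : 0 <= g p by have /andP[] := gM p.
have bC : b C = (fine (b C))%:E by rewrite fineK// ge0_fin_numE.
have mg1 y : measurable_fun setT (fun x : B => g (x, y)).
  exact: measurableT_comp.
have mg2 x : measurable_fun setT (fun y => g (x, y)) by exact: measurableT_comp.
pose mA' := mfrestr mA Aoo : {finite_measure set B -> \bar R}.
pose mC' := mfrestr mC Coo : {finite_measure set B -> \bar R}.
have gE x : \int[b]_y g (x, y) = \int[mC']_y g (x, y).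
  rewrite /Rintegral; congr fine; rewrite ge0_integral_mfrestr//.
  - rewrite [RHS]integral_mkcond; apply: eq_integral => y _.
    rewrite patchE; case: ifPn => // /negP nCy.
    have [->//|/gAC[_ Cy]] := eqVneq (g (x, y)) 0.
    by exfalso; apply: nCy; rewrite inE.
  - exact/measurable_EFinP.
  - by move=> y; rewrite lee_fin.
(* Sampling needs positive mass. On a null [C] the integral vanishes for every [x], and [0 * S = 0]
   even for infinite [S]. *)
have [C0|C0] := eqVneq (b C) 0%E.
  rewrite C0 mul0e (_ : EFin \o _ = EFin \o cst 0).
    by rewrite (xnormE hX (qb_zero qX)) (N_cst0 hX).
  apply/funext => x /=; congr EFin; rewrite gE /Rintegral.
  rewrite ge0_integral_mfrestr//; last 2 first.
  - exact/measurable_EFinP.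
  - by move=> y; rewrite lee_fin.
  rewrite null_set_integral//.
  by apply/measurable_EFinP; exact: measurable_funS (mg2 x).
have C_gt0 : (0 < b C)%E by rewrite lt0e C0 measure_ge0.
have [->|Soo] := eqVneq S +oo%E; first by rewrite gt0_muley ?leey.
have [y0 Cy0] : C !=set0.
  by apply/set0P; apply: contra_neq C0 => ->; exact: measure0.
have S0 : (0 <= S)%E := le_trans (xnorm_ge0 hX _) (gS y0 Cy0).
have SE : S = (fine S)%:E by rewrite fineK// ge0_fin_numE// ltey.
have gX y : C y -> X (fun x => g (x, y)) /\ N (fun x => g (x, y)) <= fine S.
  move=> /gS gyS; have Xg : X (fun x => g (x, y)).
    apply: (xnorm_lty hX); last by rewrite (le_lt_trans gyS)// ltey.
    exact: (caratheodory_measurable_fun_sub measurableT (mg1 y)).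
  split => //; rewrite -lee_fin -SE; apply: le_trans gyS.
  by have := xnormE hX Xg; rewrite /comp => ->.
have mC'T : mC' setT = b C by rewrite /mC' /= /mfrestr /mrestr setTI.
have mC'_gt0 : (0 < mC' setT)%E by rewrite mC'T.
have [|s [ss sC scvg]] := @sampling _ _ _ _ _ mA' mC' g M mg gM mC'_gt0 C mC.
  by rewrite /mC' /= /mfrestr /mrestr setICl measure0.
pose c := fine (b C).
have c_gt0 : 0 < c by rewrite -lte_fin -bC.
pose u j x := c / (2 ^ j)%:R * \sum_(y <- s j) g (x, y).
have mu j : measurable_fun (setT : set (Rn R n)) (u j).
  apply: (caratheodory_measurable_fun_sub measurableT).
  by apply: measurable_funM => //; apply: measurable_sum.
apply: (@xnorm_lim_le _ _ _ _ hX u).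
- exact: mu.
- apply: (caratheodory_measurable_fun_sub measurableT).
  apply: measurableT_comp => //.
  apply: (measurable_fun_fubini_tonelli_F (EFin \o g)).
    exact/measurable_EFinP.
  by move=> p; rewrite lee_fin.
- move=> j x; rewrite mulr_ge0// ?sumr_ge0// divr_ge0// ltW//.
(* Sampling yields convergence only a.e. on [A]; off [A] both the averages and the integral
   vanish. *)
- apply: completion_negligible.
  move: scvg => /ae_mfrestr; apply: filterS => x ux.
  have [Ax|nAx] := pselect (A x).
    have := cvgM (cvg_cst c) (ux Ax).
    rewrite mC'T mulrA divff ?gt_eqF// mul1r -gE => cu.
    rewrite (_ : u ^~ x =
      (fun j => c * ((2 ^ j)%:R^-1 * \sum_(y <- s j) g (x, y)))).
      exact: cu.
    by apply/funext => j; rewrite /u -mulrA.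
  have gx0 y : g (x, y) = 0.
    by apply/eqP; apply: contrapT => /negP /gAC[].
  rewrite /Rintegral integral0_eq => [|y _]; last by rewrite gx0.
  rewrite (_ : u ^~ x = cst 0); first exact: cvg_cst.
  apply/funext => j; rewrite /u big1 ?mulr0// => y _; exact: gx0.
- move=> j; rewrite bC SE -EFinM.
  have [Xs Ns] := @X_sum _ _ _ _ hX _ (s j) (fun y x => g (x, y))
    (fine S) triangle (fun y ys => gX y (sC j y ys)).
  rewrite xnormE//; last exact: (qb_scale qX).
  rewrite (qb_homogeneous qX)// lee_fin ger0_norm; last first.
    by rewrite divr_ge0// ltW.
  rewrite -mulrA ler_pM2l// ler_pdivrMl ?ltr0n ?expn_gt0//.
  by rewrite -(ss j).
Qed.
End bounded_case.

(** * Borel representatives of Lebesgue measurable data *)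

Lemma ae_xsection_eq0 d1 d2 (T1 : measurableType d1) (T2 : measurableType d2)
    (R : realType) (m1 : {measure set T1 -> \bar R})
    (m2 : {sigma_finite_measure set T2 -> \bar R}) (Z : set (T1 * T2)) :
  measurable Z -> (m1 \x m2)%E Z = 0%E ->
  {ae m1, forall x, m2 (xsection Z x) = 0%E}.
Proof.
move=> mZ Z0; have mx := measurable_fun_xsection m2 mZ.
have /(ae_eq_integral_abs m1 measurableT mx) :
    (\int[m1]_x `|m2 (xsection Z x)| = 0)%E.
  by rewrite -[RHS]Z0; apply: eq_integral => x _; rewrite gee0_abs.
by apply: filterS => x /(_ I).
Qed.

Section borel_representative.
Context (R : realType) (n : nat).
Local Notation B := (n.-tuple (measurableTypeR R)).
Local Notation b := (@borel_lebesgue R n).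

Lemma leb_complete : measure_is_complete (leb R n).
Proof. exact: measure_is_complete_caratheodory. Qed.

(** The strip over [E0] is Borel. The strip over the rest lies in the strip over a null Borel set,
    which has product measure 0 even if the other factor has infinite measure, since
    [+oo * 0 = 0]. *)
Lemma setTX_measurable (E : set (Rn R n)) (E0 : set B) : measurable E0 ->
  E0 `<=` E -> b.-negligible (E `\` E0) ->
  measurable ([set: Rn R n] `*` E : set (RnRn R n)).
Proof.
move=> mE0 E0E [Z [mZ Z0 EZ]].
rewrite (_ : _ `*` _ = ([set: B] `*` E0) `|` ([set: B] `*` (E `\` E0))).
  apply: measurableU.
    by apply: caratheodory_measurable_mu_ext; exact: measurableX.
  apply: measure_is_complete_caratheodory.
  exists ([set: B] `*` Z); split.
  - by apply: caratheodory_measurable_mu_ext; exact: measurableX.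
  - rewrite /= measurable_mu_extE; last exact: measurableX.
    transitivity (b setT * b Z)%E; first exact: product_measure1E.
    by rewrite Z0 mule0.
  - by move=> p [_ /EZ].
apply/seteqP; split => [[x y] [_ Ey]|[x y] [[_ /E0E]|[_ []]]]//.
by have [E0y|nE0y] := pselect (E0 y); [left|right].
Qed.

(** The function [h] is [|F|] cut off outside a Borel set [D] on which [F] is Borel. Approximating
    [E] from inside makes the bound by [|F|] and the support condition hold at every point, so each
    section of [h] over [E0] stays below a section counted in the supremum over [E]. The integrals
    agree at those [x] for which the section of the exceptional set [Z] is null. *)
Lemma borel_representative (E : set (Rn R n)) (F : Rn R n * Rn R n -> R) :
  measurable E ->
  measurable_fun ([set: Rn R n] `*` E : set (RnRn R n)) (F : RnRn R n -> R) ->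
  exists (E0 : set B) (h : B * B -> R),
  [/\ measurable E0 /\ E0 `<=` E, measurable_fun setT h,
    forall p, 0 <= h p <= `|F p|, forall p, h p != 0 -> E0 p.2 &
    {ae leb R n, forall x,
      (\int[leb R n]_(y in E) `|F (x, y)|%:E = \int[b]_y (h (x, y))%:E)%E}].
Proof.
move=> mE mF.
have [E0 [mE0 E0E nE0]] := caratheodory_inner_approx (sigma_finiteT b) mE.
have mTE := setTX_measurable mE0 E0E nE0.
have mTE0 : measurable ([set: B] `*` E0) by exact: measurableX.
have [|Z [mZ Z0 mFZ]] :=
    @caratheodory_measurable_fun _ _ _ _ (sigma_finite_product b b) _ F mTE0.
  by apply: measurable_funS mF => // p [_ /E0E].
pose D := ([set: B] `*` E0) `\` Z.
have mD : measurable D by exact: measurableD.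
pose h := (fun p => `|F p|) \_ D.
have mh : measurable_fun setT h.
  apply/measurable_restrict => //; rewrite setTI.
  exact: measurableT_comp mFZ.
have hF p : 0 <= h p <= `|F p|.
  by rewrite /h patchE; case: ifPn => _; rewrite normr_ge0 lexx.
have h_ge0 p : 0 <= h p by have /andP[] := hF p.
have hE0 p : h p != 0 -> E0 p.2.
  by rewrite /h patchE; case: ifPn => [|_ /eqP//]; rewrite inE => -[[]].
exists E0, h; split => //.
have aeZ : {ae leb R n, forall x : Rn R n, b (xsection Z x) = 0%E}.
  exact: completion_negligible (ae_xsection_eq0 mZ Z0).
have mhx (x : B) : measurable_fun setT (fun y : B => (h (x, y))%:E).
  by apply/measurable_EFinP; exact: measurableT_comp.
apply: filterS aeZ => x Zx0.
have nEZ : b.-negligible ((E `\` E0) `|` xsection Z x).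
  apply: negligibleU => //.
  by exists (xsection Z x); split => //; exact: measurable_xsection.
have hE : ae_eq (leb R n) E (fun y => (h (x, y))%:E) (fun y => `|F (x, y)|%:E).
  apply: negligibleS (completion_negligible nEZ) => y /= /not_implyP[Ey hy].
  have [E0y|nE0y] := pselect (E0 y); last by left.
  right; rewrite /xsection /= inE; apply: contrapT => nZ; apply: hy.
  by rewrite /h patchE mem_set.
have mhE : measurable_fun (E : set (Rn R n)) (fun y => (h (x, y))%:E).
  by apply: measurable_funS
    (caratheodory_measurable_fun_sub measurableT (mhx x)).
(* A section of a function measurable for the completed product need not be measurable. This one
   agrees a.e. on [E] with a Borel section, and Lebesgue measure is complete. *)
have mFE : measurable_fun (E : set (Rn R n)) (fun y => `|F (x, y)|%:E).
  exact: ae_measurable_fun leb_complete _ _ _ hE mhE.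
rewrite -(ge0_ae_eq_integral mE mhE mFE _ _ hE); last 2 first.
- by move=> y _; rewrite lee_fin h_ge0.
- by move=> y _; rewrite lee_fin.
rewrite -(ge0_integral_completion b measurableT (mhx x)); last first.
  by move=> y; rewrite lee_fin h_ge0.
rewrite integral_mkcond; apply: eq_integral => y _.
rewrite patchE; case: ifPn => // /negP nEy.
have [->//|/hE0/= E0y] := eqVneq (h (x, y)) 0.
by exfalso; apply: nEy; rewrite inE; exact: E0E.
Qed.

End borel_representative.

(** * Truncation and passage to the general case *)

Theorem lemma3p4 (R : realType) (n : nat)
  (X : set (Rn R n -> R)) (N : (Rn R n -> R) -> R)
  (hX : ball_quasi_banach X N)
  (triangle : forall f g, X f -> X g -> N (f \+ g) <= N f + N g)
  (E : set (Rn R n)) (mE : measurable E)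
  (F : Rn R n * Rn R n -> R)
  (mF : measurable_fun ([set: Rn R n] `*` E : set (RnRn R n)) (F : RnRn R n -> R)) :
  (xnorm X N (fun x => \int[leb R n]_(y in E) `|F (x, y)|%:E) <=
   leb R n E * ereal_sup [set xnorm X N (fun x => (F (x, y))%:E) | y in E])%E.
Proof.
set S := ereal_sup _.
have [E0 [h [[mE0 E0E] mh hF hE0 intE]]] := borel_representative mE mF.
have h_ge0 p : 0 <= h p by have /andP[] := hF p.
(* For empty [E] the supremum is [-oo], and the product is 0 by the convention [0 * x = 0]. *)
have ES0 : (0 <= leb R n E * S)%E.
  have [E_eq0|/set0P[y Ey]] := eqVneq E set0.
    by rewrite [X in leb R n X]E_eq0 measure0 mul0e.
  rewrite mule_ge0//.
  apply: (@le_trans _ _ (xnorm X N (fun x => (F (x, y))%:E))).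
    exact: xnorm_ge0 hX _.
  by apply: ereal_sup_ubound; exists y.
have /sigma_finiteP[A [TA ndA /all_and2[mA Aoo]]] :=
  sigma_finiteT (@borel_lebesgue R n).
(* Cutting [h] at height [k] and to the square of [A k] gives a bounded function supported on a
   product of sets of finite measure; [g k] increases to [h]. *)
pose g k p := Num.min (h p) k%:R * (\1_(A k) p.1 * \1_(A k) p.2).
have mg k : measurable_fun setT (g k).
  apply: measurable_funM; first exact: measurable_minr.
  apply: measurable_funM; apply: measurableT_comp => //;
    exact: measurable_indic.
have g_ge0 k p : 0 <= g k p.
  by rewrite mulr_ge0 ?le_min ?h_ge0//= mulr_ge0// indicE.
have ind_le1 k p : \1_(A k) p.1 * \1_(A k) p.2 <= 1 :> R.
  by rewrite !indicE -natrM lern1; do 2 case: (_ \in _).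
have ind_ge0 k p : 0 <= \1_(A k) p.1 * \1_(A k) p.2 :> R.
  by rewrite mulr_ge0// indicE.
have g_leh k p : g k p <= h p.
  rewrite -[leRHS]mulr1 ler_pM// ?le_min ?h_ge0//=.
  by rewrite ge_min lexx.
have g_lek k p : g k p <= k%:R.
  rewrite -[leRHS]mulr1 ler_pM// ?le_min ?h_ge0//=.
  by rewrite ge_min lexx orbT.
have g_supp k x y : g k (x, y) != 0 -> A k x /\ (A k `&` E0) y.
  move=> gn0.
  have hn0 : h (x, y) != 0.
    by apply: contra_neq gn0 => hxy0; rewrite /g hxy0 min_l// mul0r.
  have [xA|xA] := boolP (x \in A k); last first.
    by move: gn0; rewrite /g /= !indicE (negbTE xA) mul0r mulr0 eqxx.
  have [yA|yA] := boolP (y \in A k); last first.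
    by move: gn0; rewrite /g /= !indicE (negbTE yA) !mulr0 eqxx.
  by split; [exact: set_mem|split; [exact: set_mem|exact: hE0 hn0]].
have mgx k (x : n.-tuple (measurableTypeR R)) :
    measurable_fun setT (fun y => (g k (x, y))%:E).
  by apply/measurable_EFinP; exact: measurableT_comp.
have mgy k (y : n.-tuple (measurableTypeR R)) :
    measurable_fun setT (fun x => g k (x, y)).
  exact: measurableT_comp.
have nd_g p : {homo g ^~ p : i j / (i <= j)%N >-> i <= j}.
  move=> i j ij; rewrite ler_pM// ?le_min ?h_ge0//=.
    by rewrite ge_min lexx/= ge_min ler_nat ij orbT.
  have indA z : \1_(A i) z <= \1_(A j) z :> R.
    rewrite !indicE ler_nat; case: (boolP (z \in A i)) => // zA.
    by rewrite (mem_set (subsetPset _ _ (ndA _ _ ij) _ (set_mem zA))).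
  by rewrite ler_pM// indicE.
have cvg_g p : g k p @[k --> \oo] --> h p.
  have [i _ Ai] : (\bigcup_k A k) p.1 by rewrite -TA.
  have [j _ Aj] : (\bigcup_k A k) p.2 by rewrite -TA.
  (* The sequence is stationary once both coordinates lie in [A k] and [k] exceeds [h p]. *)
  apply: cvg_near_cst.
  exists (maxn (maxn i j) (Num.truncn (h p)).+1) => // k /=.
  rewrite !geq_max => /andP[/andP[ik jk] hk].
  rewrite /g !indicE !mem_set ?mulr1.
  - rewrite min_l// (le_trans (ltW (truncnS_gt _)))// ler_nat//.
  - exact: (subsetPset _ _ (ndA _ _ jk)).
  - exact: (subsetPset _ _ (ndA _ _ ik)).
pose G k x := \int[@borel_lebesgue R n]_y g k (x, y).
have GE k x : (G k x)%:E = (\int[@borel_lebesgue R n]_y (g k (x, y))%:E)%E.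
  rewrite /G /Rintegral fineK// ge0_fin_numE; last first.
    by apply: integral_ge0 => y _; rewrite lee_fin.
  apply: (@le_lt_trans _ _ (\int[@borel_lebesgue R n]_(y in A k) k%:R%:E)%E).
    rewrite [leRHS]integral_mkcond; apply: ge0_le_integral => //.
    - by move=> y _; rewrite lee_fin.
    - by apply/measurable_restrict.
    move=> y _; rewrite patchE; case: ifPn => [_|/negP yA].
      by rewrite lee_fin.
    have [->//|/g_supp[_ [Ay _]]] := eqVneq (g k (x, y)) 0.
    by exfalso; apply: yA; rewrite inE.
  rewrite integral_cst// lte_mul_pinfty// ?lee_fin//; exact: Aoo.
apply: (@xnorm_nd_lim_le _ _ _ _ hX G).
- move=> k; apply: (caratheodory_measurable_fun_sub measurableT).
  apply: measurableT_comp => //.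
  apply: (measurable_fun_fubini_tonelli_F (EFin \o g k)).
    exact/measurable_EFinP.
  by move=> p; rewrite lee_fin.
- by move=> k x; exact: Rintegral_ge0.
- move=> x i j ij; rewrite -lee_fin !GE; apply: ge0_le_integral => //.
  + by move=> y _; rewrite lee_fin.
  + by move=> y _; rewrite lee_fin; exact: nd_g.
- apply: filterS intE => x ->.
  rewrite (_ : (fun k => (G k x)%:E) =
    fun k => \int[@borel_lebesgue R n]_y (g k (x, y))%:E)%E; last first.
    by apply/funext => k; exact: GE.
  rewrite (_ : (\int[_]_y _)%E =
    \int[@borel_lebesgue R n]_y limn (fun k => (g k (x, y))%:E))%E.
    apply: cvg_monotone_convergence => //.
    + by move=> k y _; rewrite lee_fin.
    + by move=> y _ i j ij; rewrite lee_fin; exact: nd_g.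
  apply: eq_integral => y _; apply/esym/cvg_lim => //.
  apply: cvg_EFin; [exact: nearW|exact: cvg_g].
- move=> k.
  have mC : measurable (A k `&` E0) by exact: measurableI.
  have Coo : (borel_lebesgue (A k `&` E0) < +oo)%E.
    apply: le_lt_trans (Aoo k).
    by apply: le_measure; rewrite ?inE//; exact: subIsetl.
  have gS y : (A k `&` E0) y -> (xnorm X N (fun x => (g k (x, y))%:E) <= S)%E.
    (* The bounds [g k <= h <= |F|] hold everywhere and [y] lies in [E], so the section of [F] at
       this very [y] is counted in [S]. *)
    move=> [_ /E0E Ey].
    apply: (@le_trans _ _ (xnorm X N (fun x => (F (x, y))%:E))); last first.
      by apply: ereal_sup_ubound; exists y.
    apply: (xnorm_le hX (f := fun x => g k (x, y))).
      exact: (caratheodory_measurable_fun_sub measurableT (mgy k y)).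
    apply: aeW => x /=; rewrite lee_fin ger0_norm// (le_trans (g_leh _ _))//.
    by have /andP[] := hF (x, y).
  apply: (le_trans (xnorm_integral_bounded_le hX triangle (mA k) (Aoo k) mC Coo
    (mg k) (M := k%:R) _ (g_supp k) gS)).
    by move=> p; rewrite g_ge0 g_lek.
  (* Nonnegativity of [S] is read off at a point of the set. If there is none, the left side is 0
     and [ES0] concludes. *)
  have [->|/set0P[y Cy]] := eqVneq (A k `&` E0) set0.
    by rewrite measure0 mul0e.
  apply: lee_wpmul2r; first exact: le_trans (xnorm_ge0 hX _) (gS y Cy).
  (* By construction [leb R n E] is the outer measure of [E], so it suffices to compare outer
     measures. *)
  rewrite -(measurable_mu_extE (@borel_lebesgue R n) mC).
  by apply: le_mu_ext => z [_ /E0E].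
Qed.
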